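(* Let $V=\{v_1,v_2,v_3,v_4\}\subset\mathbb{R}^3$ be the set of vertices of a (non-degenerate) tetrahedron $T=\mathrm{co}(V)$ with circumradius $r(V)$. There exist $R^*>r(V)$, a point $O^*\in\mathrm{int}(T)$ and four distinct spheres $S_1,S_2,S_3,S_4$ of radius $R^*$ such that, for every $j$, $V\setminus\{v_j\}\subset S_j$, the open ball bounded by $S_j$ contains no point of $V$, and $O^*\in S_j$, if and only if $$r_L(V)>r(V).$$ In such a case $R^*=r_L(V)$ and $$\mathrm{co}_{R^*}(V)=V\cup\{O^*\}.$$
   Context: For a non-empty closed set $E\subset\mathbb{R}^3$ and $\rho>0$, the $\rho$-hulloid of $E$ is $\mathrm{co}_\rho(E)=\bigcap B^c$, the intersection over all open balls $B$ of radius $\rho$ with $B\cap E=\emptyset$ (equal to $\mathbb{R}^3$ if there are no such balls). The circumradius $r(V)$ is the radius of the unique sphere containing $V$. The $\rho$-hulloid of $V$ is called full if $\mathrm{int}(\mathrm{co}_\rho(V))\neq\emptyset$, and $$r_L(V)=\inf\{\rho>r(V):\ \mathrm{co}_\rho(V)\text{ is full}\}.$$ *)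

(* Defs.v *)
From HB Require Import structures.
From mathcomp Require Import all_boot all_order all_algebra.
From mathcomp Require Import all_classical all_reals all_analysis.

Set Implicit Arguments.
Unset Strict Implicit.
Unset Printing Implicit Defensive.

Import Order.TTheory GRing.Theory Num.Theory.
Import numFieldNormedType.Exports.

Local Open Scope classical_set_scope.
Local Open Scope ring_scope.

(* The library norm `|x| on 'rV[R]_n is the sup norm, so Euclidean balls and
   spheres are introduced here; the induced topology is the library's one. *)
Definition edist (R : realType) (n : nat) (x y : 'rV[R]_n) : R :=
  Num.sqrt (\sum_(i < n) (x 0 i - y 0 i) ^+ 2).

Definition eball (R : realType) (n : nat) (c : 'rV[R]_n) (r : R)
  : set 'rV[R]_n := [set x | edist c x < r].

Definition esphere (R : realType) (n : nat) (c : 'rV[R]_n) (r : R)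
  : set 'rV[R]_n := [set x | edist c x = r].

Definition convex_hull (R : realType) (n : nat) (A : set 'rV[R]_n)
  : set 'rV[R]_n := smallest (@convex_set R 'rV[R]_n) A.

Definition nondegenerate_tetrahedron (R : realType) (v : 'I_4 -> 'rV[R]_3)
  : Prop := row_free (\matrix_(i < 3) (v (lift ord0 i) - v ord0)).

(* An intersection over an empty family of balls is the whole space. *)
Definition hulloid (R : realType) (n : nat) (rho : R) (E : set 'rV[R]_n)
  : set 'rV[R]_n :=
  \bigcap_(c in [set c | eball c rho `&` E = set0]) ~` eball c rho.

(* The radius is unique when V is the vertex set of a nondegenerate
   tetrahedron; the default 0 is then not used. *)
Definition circumradius (R : realType) (n : nat) (V : set 'rV[R]_n) : R :=
  xget 0 [set r | 0 < r /\ exists c, V `<=` esphere c r].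

Definition full_hulloid (R : realType) (n : nat) (rho : R) (V : set 'rV[R]_n)
  : Prop := (hulloid rho V)° !=set0.

(* For a nondegenerate tetrahedron the set below is nonempty (its hulloids are
   full for all large rho) and bounded below by circumradius V, so that the
   real-valued inf is the genuine infimum. *)
Definition rL (R : realType) (n : nat) (V : set 'rV[R]_n) : R :=
  inf [set rho | circumradius V < rho /\ full_hulloid rho V].

(* The spheres S_j are given by their centres c j and their common radius Rs. *)
Definition four_spheres (R : realType) (v : 'I_4 -> 'rV[R]_3)
    (Rs : R) (O : 'rV[R]_3) (c : 'I_4 -> 'rV[R]_3) : Prop :=
  [/\ circumradius (range v) < Rs,
      (convex_hull (range v))° O,
      injective (fun j => esphere (c j) Rs) &
      forall j,
        [/\ range v `\ v j `<=` esphere (c j) Rs,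
            eball (c j) Rs `&` range v = set0 &
            esphere (c j) Rs O]].

(* Main.v *)
(** Let [r] be the circumradius and [c0] the circumcenter of [V], let [mu j] be
    the barycentric coordinates and put [q x = r^2 - |x - c0|^2].  For [rho > r]
    the sphere of radius [rho] through [V \ {v j}] whose ball avoids [v j] has
    centre [c0 - s_j grad (mu j)], where [s_j] is the positive root of a
    quadratic equation, and [x] lies outside its ball iff
    [q x <= 2 s_j mu j x].  The hulloid consists of the points of the tetrahedron
    satisfying these four inequalities.

    With [w_j = 1 / (2 s_j)], [W = sum_j w_j] and [p] the point with barycentric
    coordinates [w_j / W], Leibniz's formula gives
    [sum_j (mu j x - w_j q x) |x - v j|^2 = q x (1 - W q p - W |x - p|^2)].
    Hence [W q p + W |x - p|^2 <= 1] for every non-vertex [x] of the hulloid, so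
    that the hulloid is full iff [W q p < 1] and equals [V] together with [p] if
    [W q p = 1]; the latter equality means precisely that the four spheres meet
    in [p].  As the [w_j] decrease with [rho], [W q p] takes the value [1] at
    most once, and it is smaller than [1] afterwards. *)

Require Import Defs.
From HB Require Import structures.
From mathcomp Require Import all_boot all_order all_algebra.
From mathcomp Require Import all_classical all_reals all_analysis.
From mathcomp Require Import ring lra.

Set Implicit Arguments.
Unset Strict Implicit.
Unset Printing Implicit Defensive.

Import Order.TTheory GRing.Theory Num.Theory.
Import numFieldNormedType.Exports.

Local Open Scope classical_set_scope.
Local Open Scope ring_scope.

(** * Dot product and squared Euclidean distance *)

Lemma cvg_sumr (K : numFieldType) (V : normedModType K) (T : Type)
    (F : set_system T) {FF : Filter F} (I : finType) (f : I -> T -> V)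
    (l : I -> V) :
  (forall i, f i x @[x --> F] --> l i) ->
  \sum_i f i x @[x --> F] --> \sum_i l i.
Proof. by move=> fl; apply: cvg_big => //; exact: add_continuous. Qed.

Section dot_product.
Variables (R : realType) (n : nat).
Implicit Types x y z c : 'rV[R]_n.

Definition dotv x y : R := \sum_i x 0 i * y 0 i.

Lemma dotvC x y : dotv x y = dotv y x.
Proof. by apply: eq_bigr => i _; rewrite mulrC. Qed.

Lemma dotvDl x y z : dotv (x + y) z = dotv x z + dotv y z.
Proof. by rewrite -big_split; apply: eq_bigr => i _; rewrite mxE mulrDl. Qed.

Lemma dotvZl (a : R) x z : dotv (a *: x) z = a * dotv x z.
Proof. by rewrite mulr_sumr; apply: eq_bigr => i _; rewrite mxE mulrA. Qed.

Lemma dotvNl x z : dotv (- x) z = - dotv x z.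
Proof. by rewrite -scaleN1r dotvZl mulN1r. Qed.

Lemma dotvBl x y z : dotv (x - y) z = dotv x z - dotv y z.
Proof. by rewrite dotvDl dotvNl. Qed.

Lemma dotv0l z : dotv 0 z = 0.
Proof. by rewrite -(subrr z) dotvBl subrr. Qed.

Lemma dotv_suml (I : finType) (F : I -> 'rV[R]_n) z :
  dotv (\sum_i F i) z = \sum_i dotv (F i) z.
Proof.
exact: (big_morph (dotv^~ z) (fun x y => dotvDl x y z) (dotv0l z)).
Qed.

Lemma dotvZr (a : R) x z : dotv z (a *: x) = a * dotv z x.
Proof. by rewrite dotvC dotvZl (dotvC z). Qed.

Lemma dotvBr x y z : dotv z (x - y) = dotv z x - dotv z y.
Proof. by rewrite dotvC dotvBl !(dotvC z). Qed.

Lemma dotv0r z : dotv z 0 = 0.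
Proof. by rewrite dotvC dotv0l. Qed.

Lemma dotv_sumr (I : finType) (F : I -> 'rV[R]_n) z :
  dotv z (\sum_i F i) = \sum_i dotv z (F i).
Proof. by rewrite dotvC dotv_suml; apply: eq_bigr => i _; rewrite dotvC. Qed.

Lemma dotvv_ge0 x : 0 <= dotv x x.
Proof. by apply: sumr_ge0 => i _; rewrite -expr2 sqr_ge0. Qed.

Lemma dotvv_eq0 x : (dotv x x == 0) = (x == 0).
Proof.
apply/idP/eqP => [|->]; last by rewrite dotv0l.
rewrite psumr_eq0 => [/allP x0|i _]; last by rewrite -expr2 sqr_ge0.
apply/rowP => i; rewrite mxE; apply/eqP.
by have := x0 i (mem_index_enum i); rewrite -expr2 sqrf_eq0.
Qed.

Lemma dotv_ext x y : (forall z, dotv x z = dotv y z) -> x = y.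
Proof.
move=> xy; apply/eqP; rewrite -subr_eq0 -dotvv_eq0 dotvBl.
by rewrite (xy (x - y)) subrr.
Qed.

Definition sqdist x y : R := dotv (x - y) (x - y).

Lemma sqdist_ge0 x y : 0 <= sqdist x y.
Proof. exact: dotvv_ge0. Qed.

Lemma sqdist_eq0 x y : (sqdist x y == 0) = (x == y).
Proof. by rewrite dotvv_eq0 subr_eq0. Qed.

Lemma sqdistxx x : sqdist x x = 0.
Proof. by apply/eqP; rewrite sqdist_eq0. Qed.

Lemma sqdist_split x y z :
  sqdist x z = sqdist x y + sqdist y z + 2 * dotv (x - y) (y - z).
Proof.
rewrite /sqdist !dotvBl !dotvBr (dotvC y x) (dotvC z x) (dotvC z y); ring.
Qed.

Lemma edistE x y : Defs.edist x y = Num.sqrt (sqdist x y).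
Proof.
by congr Num.sqrt; apply: eq_bigr => i _; rewrite !mxE expr2.
Qed.

Lemma edist_ltE c x (r : R) : 0 < r -> (Defs.edist c x < r) = (sqdist c x < r ^+ 2).
Proof.
move=> r0; rewrite edistE -[in LHS](ger0_norm (ltW r0)) -sqrtr_sqr.
by rewrite ltr_sqrt ?exprn_gt0.
Qed.

Lemma edist_eqE c x (r : R) : 0 < r -> Defs.edist c x = r <-> sqdist c x = r ^+ 2.
Proof.
move=> r0; rewrite edistE; split => [<-|->]; first by rewrite sqr_sqrtr ?sqdist_ge0.
by rewrite sqrtr_sqr gtr0_norm.
Qed.

Lemma eball_emptyP (I : Type) (v : I -> 'rV[R]_n) c (r : R) : 0 < r ->
  eball c r `&` range v = set0 <-> forall i, r ^+ 2 <= sqdist c (v i).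
Proof.
move=> r0; split => [cv0 i|cv]; last first.
  rewrite -subset0 => x [/= cx [i _ vx]]; move: cx.
  by rewrite -vx /eball/= edist_ltE// ltNge cv.
rewrite leNgt; apply/negP => civ.
suff : (eball c r `&` range v) (v i) by rewrite cv0.
by split; [rewrite /eball/= edist_ltE|exists i].
Qed.

Lemma dotv_continuous z : continuous (dotv z).
Proof.
move=> x; apply: (@cvg_sumr _ _ _ (nbhs x) _) => i.
by apply: cvgM; [exact: cvg_cst|exact: coord_continuous].
Qed.

Lemma sqdist_continuous c : continuous (sqdist c).
Proof.
move=> x; apply: (@cvg_sumr _ _ _ (nbhs x) _) => i.
by apply: cvgM; (have -> : (fun y : 'rV[R]_n => (c - y) 0 i) = (fun y => c 0 i - y 0 i)
  by apply/funext => y; rewrite !mxE); rewrite !mxE; apply: cvgB;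
  solve [exact: cvg_cst|exact: coord_continuous].
Qed.

End dot_product.

(** * The positive root of a quadratic equation *)

Section positive_quadratic_root.
Variable R : realType.
Implicit Types a m k s t : R.

(** The larger root [s] of [a * s ^+ 2 - 2 * m * s = k]; for positive [a] and [k] the roots have
    opposite signs, so it is the only positive one. *)
Definition qroot a m k := (m + Num.sqrt (m ^+ 2 + a * k)) / a.

Lemma qroot_gt0 a m k : 0 < a -> 0 < k -> 0 < qroot a m k.
Proof.
move=> a0 k0; rewrite divr_gt0// -ltrBlDl sub0r.
apply: (le_lt_trans (ler_norm _)); rewrite normrN -sqrtr_sqr ltr_sqrt.
  by rewrite ltrDl mulr_gt0.
by rewrite ltr_wpDl ?sqr_ge0// mulr_gt0.
Qed.

Lemma qrootK a m k : 0 < a -> 0 < k ->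
  a * qroot a m k ^+ 2 - 2 * m * qroot a m k = k.
Proof.
move=> a0 k0; rewrite /qroot; set s := Num.sqrt _.
have s2 : s ^+ 2 = m ^+ 2 + a * k.
  by rewrite sqr_sqrtr// addr_ge0 ?sqr_ge0// mulr_ge0 ?ltW.
have -> : a * ((m + s) / a) ^+ 2 - 2 * m * ((m + s) / a) = (s ^+ 2 - m ^+ 2) / a.
  by field; rewrite gt_eqF.
by rewrite s2; field; rewrite gt_eqF.
Qed.

(** Once [s * (a * s - 2 * m)] is positive with [s > 0], both factors are positive, and both
    increase with [s]. *)
Lemma quadratic_lt a m s t : 0 < a -> 0 < s -> s < t ->
  0 < a * s ^+ 2 - 2 * m * s -> a * s ^+ 2 - 2 * m * s < a * t ^+ 2 - 2 * m * t.
Proof.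
move=> a0 s0 st; have -> : a * s ^+ 2 - 2 * m * s = s * (a * s - 2 * m) by ring.
rewrite pmulr_rgt0// => sm.
have -> : a * t ^+ 2 - 2 * m * t = t * (a * t - 2 * m) by ring.
have ast : a * s < a * t by rewrite ltr_pM2l.
rewrite -subr_gt0.
have -> : t * (a * t - 2 * m) - s * (a * s - 2 * m) =
  (t - s) * (a * t - 2 * m) + s * (a * t - a * s) by ring.
by rewrite addr_gt0// mulr_gt0// ?subr_gt0//; lra.
Qed.

Lemma lt_qroot a m k s : 0 < a -> 0 < k -> 0 < s ->
  a * s ^+ 2 - 2 * m * s < k -> s < qroot a m k.
Proof.
move=> a0 k0 s0 ks; have q0 := qroot_gt0 m a0 k0; have qk := qrootK m a0 k0.
rewrite ltNge; apply/negP; rewrite le_eqVlt => /predU1P[sq|].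
  by move: ks; rewrite -sq qk ltxx.
by move=> /(@quadratic_lt a m _ _ a0 q0); rewrite qk => /(_ k0) ?; lra.
Qed.

Lemma qroot_unique a m k s : 0 < a -> 0 < k -> 0 < s ->
  a * s ^+ 2 - 2 * m * s = k -> s = qroot a m k.
Proof.
move=> a0 k0 s0 ks; have q0 := qroot_gt0 m a0 k0; have qk := qrootK m a0 k0.
have [sq|qs|//] := ltgtP s (qroot a m k).
- by have := quadratic_lt (m := m) a0 s0 sq; rewrite ks qk ltxx => /(_ k0).
- by have := quadratic_lt (m := m) a0 q0 qs; rewrite ks qk ltxx => /(_ k0).
Qed.

Lemma qroot_mono a m k k' : 0 < a -> 0 < k -> k < k' ->
  qroot a m k < qroot a m k'.
Proof.
move=> a0 k0 kk'; apply: lt_qroot; rewrite ?qrootK// ?qroot_gt0//.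
exact: lt_trans kk'.
Qed.

End positive_quadratic_root.

Lemma exists_neq (n : nat) (j : 'I_n.+2) : exists i, i != j.
Proof.
have [->|j0] := eqVneq j ord0; last by exists ord0; rewrite eq_sym.
by exists (lift ord0 ord0).
Qed.

(** * Barycentric coordinates and their gradients *)

Section barycentric_coordinates.
Variables (R : realType) (n : nat) (v : 'I_n.+2 -> 'rV[R]_n.+1).
Implicit Types (x y z c : 'rV[R]_n.+1) (i j k : 'I_n.+2).

Definition edge_mx := \matrix_(i < n.+1) (v (lift ord0 i) - v ord0).

(** The columns of the inverse edge matrix are dual to the edges issued from [v ord0]; the gradient
    of index [ord0] is the one that makes all gradients sum to zero. *)
Definition bary_grad j : 'rV[R]_n.+1 :=
  if unlift ord0 j is Some i then (col i (invmx edge_mx))^T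
  else - \sum_i (col i (invmx edge_mx))^T.

Definition bary j x : R :=
  (j == ord0)%:R + dotv (bary_grad j) (x - v ord0).

Lemma bary_lift (i : 'I_n.+1) x :
  bary (lift ord0 i) x = ((x - v ord0) *m invmx edge_mx) 0 i.
Proof.
rewrite /bary /bary_grad liftK mxE add0r.
by apply: eq_bigr => k _; rewrite !mxE mulrC.
Qed.

Lemma bary_sum x : \sum_j bary j x = 1.
Proof.
rewrite big_ord_recl /bary /bary_grad unlift_none eqxx dotvNl dotv_suml.
under [X in _ + X]eq_bigr do rewrite liftK add0r.
by rewrite subrK.
Qed.

Lemma bary_sub j x y : bary j x - bary j y = dotv (bary_grad j) (x - y).
Proof. by rewrite /bary !dotvBr; ring. Qed.

Lemma bary_grad_sum : \sum_j bary_grad j = 0.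
Proof.
apply: dotv_ext => z; rewrite dotv_suml dotv0l.
rewrite (eq_bigr (fun j => bary j z - bary j 0)) => [|j _]; last first.
  by rewrite bary_sub subr0.
by rewrite sumrB !bary_sum subrr.
Qed.

Lemma bary_continuous j : continuous (bary j).
Proof.
move=> x; have -> : bary j = fun y => bary j 0 + dotv (bary_grad j) y.
  by apply/funext => y; rewrite -[X in dotv _ X]subr0 -bary_sub; ring.
by apply: (@cvgD _ _ _ (nbhs x)); [exact: cvg_cst|exact: dotv_continuous].
Qed.

Hypothesis hv : row_free edge_mx.

Lemma bary_comb x : \sum_j bary j x *: v j = x.
Proof.
rewrite -[LHS](addrNK (v ord0)) -[X in _ - X + _]scale1r -(bary_sum x).
rewrite scaler_suml -sumrB.
under eq_bigr do rewrite -scalerBr.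
rewrite big_ord_recl subrr scaler0 add0r.
have -> : \sum_(i < n.+1) bary (lift ord0 i) x *: (v (lift ord0 i) - v ord0) =
    (x - v ord0) *m invmx edge_mx *m edge_mx.
  rewrite [RHS]mulmx_sum_row; apply: eq_bigr => i _.
  by rewrite bary_lift rowK.
by rewrite mulmxKV ?subrK// -row_free_unit.
Qed.

Lemma bary_vertex j i : bary j (v i) = (j == i)%:R.
Proof.
have liftE (k : 'I_n.+1) : bary (lift ord0 k) (v i) = (lift ord0 k == i)%:R.
  rewrite bary_lift; case: (unliftP ord0 i) => [l|] ->; last first.
    by rewrite subrr mul0mx mxE.
  have -> : v (lift ord0 l) - v ord0 = row l edge_mx by rewrite rowK.
  rewrite -row_mul mulmxV -?row_free_unit// !mxE.
  by rewrite (inj_eq lift_inj) eq_sym.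
case: (unliftP ord0 j) => [k|] ->; first exact: liftE.
have := bary_sum (v i); rewrite big_ord_recl => /(canRL (addrK _)) ->.
under eq_bigr do rewrite liftE.
have : \sum_j (j == i)%:R = 1 :> R.
  by rewrite (bigD1 i)//= eqxx big1 ?addr0// => k /negPf ->.
by rewrite big_ord_recl => /(canRL (addrK _)) ->.
Qed.

Lemma bary_eq x y : (forall j, bary j x = bary j y) -> x = y.
Proof.
move=> xy; rewrite -(bary_comb x) -(bary_comb y).
by apply: eq_bigr => j _; rewrite xy.
Qed.

Lemma bary_of_comb (a : 'I_n.+2 -> R) j : \sum_i a i = 1 ->
  bary j (\sum_i a i *: v i) = a j.
Proof.
move=> a1; apply/eqP; rewrite -subr_eq0 -(subrK (bary j 0) (bary _ _)) bary_sub.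
rewrite subr0 dotv_sumr -[bary j 0]mul1r -a1 mulr_suml -big_split/=.
rewrite (eq_bigr (fun i => a i * (j == i)%:R)); last first.
  move=> i _; rewrite dotvZr -[X in dotv _ X]subr0 -bary_sub bary_vertex; ring.
rewrite (bigD1 j)//= eqxx mulr1 big1 ?addr0 ?subrr// => i.
by rewrite eq_sym => /negPf ->; rewrite mulr0.
Qed.

Lemma vertex_inj : injective v.
Proof.
move=> i j /(congr1 (bary i)); rewrite !bary_vertex eqxx.
by have [->//|_ /eqP] := eqVneq i j; rewrite oner_eq0.
Qed.

Lemma vertex_grad j i y : dotv (bary_grad j) (v i - y) = (j == i)%:R - bary j y.
Proof. by rewrite -bary_sub bary_vertex. Qed.

Lemma bary_grad_sqr_gt0 j : 0 < dotv (bary_grad j) (bary_grad j).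
Proof.
rewrite lt_neqAle dotvv_ge0 andbT eq_sym dotvv_eq0; apply/negP => /eqP ej0.
have [i ij] := exists_neq j.
have := vertex_grad j j (v i).
rewrite ej0 dotv0l bary_vertex eqxx eq_sym (negPf ij) subr0 => /eqP.
by rewrite eq_sym oner_eq0.
Qed.

(** Subtracting the barycentric expansions of [y] and [0] writes [y] as the sum of the
    [dotv (bary_grad v j) y *: v j]; pairing with [z] gives the dual expansion of [z]. *)
Lemma dotv_vertices z : \sum_j dotv z (v j) *: bary_grad j = z.
Proof.
apply: dotv_ext => y; rewrite dotv_suml -[X in _ = dotv _ X]subr0.
rewrite -{2}(bary_comb y) -{2}(bary_comb 0) dotvBr !dotv_sumr -sumrB.
apply: eq_bigr => j _; rewrite !dotvZl !dotvZr -[X in _ * dotv _ X = _]subr0 -bary_sub.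
ring.
Qed.

End barycentric_coordinates.

Lemma hulloidE (R : realType) (n : nat) (I : Type) (v : I -> 'rV[R]_n)
    (rho : R) (x : 'rV[R]_n) : 0 < rho ->
  hulloid rho (range v) x <->
  forall c, (forall i, rho ^+ 2 <= sqdist c (v i)) -> rho ^+ 2 <= sqdist c x.
Proof.
move=> r0; split => [hx c /(eball_emptyP _ _ r0) cv|hx c /= /(eball_emptyP _ _ r0) cv].
  by rewrite leNgt -edist_ltE//; apply/negP/(hx c cv).
by rewrite /eball/= edist_ltE//; apply/negP; rewrite -leNgt; exact: hx.
Qed.

(** * Circumsphere, touching balls and the inequalities describing the hulloid *)

Section circumsphere.
Variables (R : realType) (n : nat) (v : 'I_n.+2 -> 'rV[R]_n.+1).
Hypothesis hv : row_free (edge_mx v).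
Implicit Types (x y z c : 'rV[R]_n.+1) (i j k : 'I_n.+2).

Local Notation grad := (bary_grad v).
Local Notation mu := (bary v).
Local Notation r := (circumradius (range v)).

(** For a point equidistant from the vertices, the product with [v j] is [dotv (v j) (v j) / 2] up
    to a constant independent of [j]. In the expansion of [dotv_vertices] the constant drops out, as
    the gradients sum to zero. *)
Definition circumcenter := \sum_j (dotv (v j) (v j) / 2) *: grad j.
Local Notation c0 := circumcenter.

Lemma circumcenter_unique c (s : R) :
  (forall i, sqdist c (v i) = s) -> c = circumcenter.
Proof.
move=> cs; rewrite -[LHS](dotv_vertices hv).
have cv j : dotv c (v j) = dotv (v j) (v j) / 2 + (dotv c c - s) / 2.
  by rewrite -(cs j) /sqdist !dotvBl !dotvBr (dotvC (v j) c); field.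
under eq_bigr do rewrite cv scalerDl.
by rewrite big_split/= -scaler_sumr bary_grad_sum scaler0 addr0.
Qed.

Lemma circumcenter_equidistant i j : sqdist c0 (v i) = sqdist c0 (v j).
Proof.
have sumE l : \sum_k dotv (v k) (v k) / 2 * (k == l)%:R = dotv (v l) (v l) / 2.
  rewrite (bigD1 l)//= eqxx mulr1 big1 ?addr0// => k /negPf ->.
  by rewrite mulr0.
have : dotv c0 (v i - v j) = dotv (v i) (v i) / 2 - dotv (v j) (v j) / 2.
  rewrite dotv_suml -!sumE -sumrB; apply: eq_bigr => k _.
  by rewrite dotvZl vertex_grad// bary_vertex// mulrBr.
rewrite /sqdist !dotvBl !dotvBr (dotvC (v i) c0) (dotvC (v j) c0) => ?; lra.
Qed.

Lemma exists_vertex_neq x : exists i, v i != x.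
Proof.
have [v0x|] := eqVneq (v ord0) x; last by exists ord0.
exists ord_max; rewrite -v0x; apply/negP => /eqP /(vertex_inj hv) /eqP.
by rewrite eq_sym.
Qed.

Lemma weighted_sqdist_gt0 (a : 'I_n.+2 -> R) x : (forall j, 0 < a j) ->
  0 < \sum_j a j * sqdist x (v j).
Proof.
move=> a0; have [i vix] := exists_vertex_neq x.
rewrite (bigD1 i)//= ltr_pwDl//.
  rewrite mulr_gt0// lt_neqAle sqdist_ge0 andbT eq_sym sqdist_eq0.
  by rewrite eq_sym.
by apply: sumr_ge0 => j _; rewrite mulr_ge0 ?sqdist_ge0 ?ltW.
Qed.

Lemma circumradiusP : 0 < r /\ forall i, sqdist c0 (v i) = r ^+ 2.
Proof.
have r0 : 0 < Num.sqrt (sqdist c0 (v ord0)).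
  rewrite sqrtr_gt0 lt_neqAle sqdist_ge0 andbT eq_sym sqdist_eq0.
  have [i] := exists_vertex_neq c0.
  by rewrite eq_sym -!sqdist_eq0 (circumcenter_equidistant i ord0).
have vr i : sqdist c0 (v i) = Num.sqrt (sqdist c0 (v ord0)) ^+ 2.
  by rewrite sqr_sqrtr ?sqdist_ge0// (circumcenter_equidistant i ord0).
suff -> : r = Num.sqrt (sqdist c0 (v ord0)) by [].
apply: xget_unique => [|s [s0 [c cs]]].
  by split=> //; exists c0 => _ [i _ <-]; apply/edist_eqE.
have csv i : sqdist c (v i) = s ^+ 2 by apply/edist_eqE => //; apply: cs; exists i.
by rewrite -(circumcenter_unique csv) csv sqrtr_sqr gtr0_norm.
Qed.

Lemma circumradius_gt0 : 0 < r. Proof. exact: circumradiusP.1. Qed.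

Lemma sqdist_circumcenter i : sqdist c0 (v i) = r ^+ 2.
Proof. exact: circumradiusP.2. Qed.

(** Minus the power of [x] with respect to the circumsphere. *)
Definition copower x := r ^+ 2 - sqdist c0 x.

Lemma copower_vertex i : copower (v i) = 0.
Proof. by rewrite /copower sqdist_circumcenter subrr. Qed.

(** The cross terms cancel because [x] is the barycentre of the vertices with weights [mu j x]. What
    remains besides [sqdist z x] does not depend on [z], and taking [z = c0] evaluates it. *)
Lemma leibniz z x : \sum_j mu j x * sqdist z (v j) = sqdist z x + copower x.
Proof.
have E y : \sum_j mu j x * sqdist y (v j) =
    sqdist y x + \sum_j mu j x * sqdist x (v j).
  rewrite -[sqdist y x in RHS]mul1r -(bary_sum v x) mulr_suml -big_split/=.
  apply/eqP; rewrite -subr_eq0 -sumrB.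
  rewrite (eq_bigr (fun j => dotv (2 *: (y - x)) (mu j x *: x - mu j x *: v j))).
    rewrite -dotv_sumr sumrB -scaler_suml bary_sum scale1r bary_comb//.
    by rewrite subrr dotv0r.
  by move=> j _; rewrite -scalerBr dotvZr dotvZl (sqdist_split y x (v j)); ring.
rewrite E; congr (_ + _); rewrite /copower.
have := E c0; under eq_bigr do rewrite sqdist_circumcenter.
by rewrite -mulr_suml bary_sum mul1r => ->; ring.
Qed.

Lemma copowerE x : copower x = \sum_j mu j x * sqdist x (v j).
Proof. by rewrite leibniz sqdistxx add0r. Qed.

Lemma copower_ge0 x : (forall j, 0 <= mu j x) -> 0 <= copower x.
Proof.
by move=> x0; rewrite copowerE sumr_ge0// => j _; rewrite mulr_ge0// sqdist_ge0.
Qed.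

Lemma copower_gt0 x : (forall j, 0 < mu j x) -> 0 < copower x.
Proof. by move=> x0; rewrite copowerE weighted_sqdist_gt0. Qed.

Lemma copower_eq0 x : (forall j, 0 <= mu j x) -> copower x = 0 -> range v x.
Proof.
move=> x0; rewrite copowerE => /eqP; rewrite psumr_eq0 => [/allP sx|j _]; last first.
  by rewrite mulr_ge0// sqdist_ge0.
have [i mi] : exists i, mu i x != 0.
  apply/existsP; rewrite -negb_forall; apply/negP => /forallP m0.
  have /eqP := bary_sum v x; rewrite big1 1?eq_sym ?oner_eq0// => i _.
  exact/eqP.
have := sx i (mem_index_enum i).
by rewrite mulf_eq0 (negPf mi)/= sqdist_eq0 => /eqP ->; exists i.
Qed.

Lemma copower_continuous : continuous copower.
Proof.
move=> x; apply: (@cvgB _ _ _ (nbhs x)); first exact: cvg_cst.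
exact: sqdist_continuous.
Qed.

(** Moving the centre from [c0] by [- s *: grad j] keeps it equidistant from the vertices other than
    [v j]; the quadratic equation says that this distance is [rho]. With the positive root, [v j] is
    farther away. *)
Definition offset (rho : R) j :=
  qroot (dotv (grad j) (grad j)) (mu j c0) (rho ^+ 2 - r ^+ 2).

Definition touch_center (rho : R) j := c0 - offset rho j *: grad j.

Lemma sqr_circumradius_lt (rho : R) : r < rho -> 0 < rho ^+ 2 - r ^+ 2.
Proof.
move=> rr; have r0 := circumradius_gt0; have rho0 := lt_trans r0 rr.
by rewrite subr_gt0 ltr_pXn2r// nnegrE ltW.
Qed.

Lemma offset_gt0 (rho : R) j : r < rho -> 0 < offset rho j.
Proof. by move=> /sqr_circumradius_lt ?; rewrite qroot_gt0// bary_grad_sqr_gt0. Qed.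

Lemma offset_lt (rho rho' : R) j : r < rho -> rho < rho' ->
  offset rho j < offset rho' j.
Proof.
move=> rr rr'; apply: qroot_mono; rewrite ?bary_grad_sqr_gt0 ?sqr_circumradius_lt//.
have r0 := lt_trans circumradius_gt0 rr.
have r0' := lt_trans r0 rr'.
by rewrite ltrD2r ltr_pXn2r// nnegrE ltW.
Qed.

Lemma sqdist_shift c (s : R) j x : sqdist (c - s *: grad j) x =
  sqdist c x + 2 * s * (mu j x - mu j c) + s ^+ 2 * dotv (grad j) (grad j).
Proof.
rewrite bary_sub /sqdist !dotvBl !dotvBr !dotvZl !dotvZr.
by rewrite (dotvC x c) (dotvC (grad j) c) (dotvC (grad j) x); ring.
Qed.

Lemma sqdist_touch (rho : R) j x : r < rho ->
  sqdist (touch_center rho j) x = rho ^+ 2 - copower x + 2 * offset rho j * mu j x.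
Proof.
move=> rr; rewrite /touch_center sqdist_shift /copower.
have := qrootK (mu j c0) (bary_grad_sqr_gt0 hv j) (sqr_circumradius_lt rr).
by rewrite -/(offset rho j) => ?; lra.
Qed.

Lemma touch_avoids (rho : R) j i : r < rho ->
  rho ^+ 2 <= sqdist (touch_center rho j) (v i).
Proof.
move=> rr; rewrite sqdist_touch// copower_vertex subr0 lerDl bary_vertex//.
by rewrite mulr_ge0// mulr_ge0// ltW// offset_gt0.
Qed.

(** A point strictly behind the face opposite [v j] is cut off by the ball centred at
    [x - s *: grad j]: for the [s] chosen below, the squared distance to [x] is
    [rho ^+ 2 + 2 * s * mu j x], and that to [v i] is at least [rho ^+ 2]. *)
Lemma hulloid_bary_ge0 (rho : R) x j : 0 < rho ->
  hulloid rho (range v) x -> 0 <= mu j x.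
Proof.
move=> r0 /(hulloidE _ _ r0) hx; rewrite leNgt; apply/negP => mx.
have E0 := bary_grad_sqr_gt0 hv j; have k0 : 0 < rho ^+ 2 by rewrite exprn_gt0.
set s := qroot (dotv (grad j) (grad j)) (mu j x) (rho ^+ 2).
have s0 : 0 < s by exact: qroot_gt0.
have sE : dotv (grad j) (grad j) * s ^+ 2 - 2 * mu j x * s = rho ^+ 2 by exact: qrootK.
have : rho ^+ 2 <= sqdist (x - s *: grad j) x.
  apply: hx => i; rewrite sqdist_shift -sE bary_vertex// -subr_ge0.
  have -> (a b d m e : R): a + 2 * b * (d - m) + b ^+ 2 * e - (e * b ^+ 2 - 2 * m * b) =
     a + 2 * b * d by ring.
  by rewrite addr_ge0 ?sqdist_ge0// mulr_ge0// mulr_ge0// ltW.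
rewrite sqdist_shift sqdistxx subrr mulr0 !add0r -sE.
have : 0 < s * - mu j x by rewrite mulr_gt0// oppr_gt0.
nra.
Qed.

(* Seen from the circumcenter, a centre [c] admissible for the hulloid lies in
   the normal cone of the vertex [v k] maximizing [dotv (c - c0)], that is in
   the cone over the touching centres other than the [k]-th; it cannot lie
   strictly below them since these are at distance [rho] from [v k]. *)
Lemma hulloidP (rho : R) x : r < rho -> hulloid rho (range v) x <->
  forall j, 0 <= mu j x /\ copower x <= 2 * offset rho j * mu j x.
Proof.
move=> rr; have r0 := lt_trans circumradius_gt0 rr.
split=> [hx j|hx].
  split; first exact: hulloid_bary_ge0 hx.
  move: hx => /(hulloidE _ _ r0) /(_ (touch_center rho j)).
  move=> /(_ (fun i => touch_avoids _ _ rr)); rewrite sqdist_touch//; lra.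
apply/hulloidE => // c cv; rewrite leNgt; apply/negP => cx.
have x0 j : 0 <= mu j x by have [] := hx j.
have q0 := copower_ge0 x0.
pose w := c - c0.
have [k kmax] : exists k, forall j, dotv w (v j) <= dotv w (v k).
  have [k _ kP] := @arg_maxP _ _ _ ord0 xpredT (fun j => dotv w (v j)) isT.
  by exists k => j; exact: kP.
pose a j := dotv w (v k) - dotv w (v j).
(* These are the coefficients of [c - c0] on the vectors [touch_center rho j - c0]; the maximality
   of [k] makes them nonnegative. *)
pose t j := a j / offset rho j.
have a0 j : 0 <= a j by rewrite subr_ge0.
have t0 j : 0 <= t j by rewrite divr_ge0// ltW// offset_gt0.
have tk : t k = 0 by rewrite /t /a subrr mul0r.
have at_ j : a j = t j * offset rho j by rewrite divfK// gt_eqF// offset_gt0.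
have wE : w = \sum_j t j *: (touch_center rho j - c0).
  have s0 : \sum_j dotv w (v k) *: grad j = 0.
    by rewrite -scaler_sumr bary_grad_sum scaler0.
  rewrite -[LHS](dotv_vertices hv) -[LHS]subr0 -[X in _ - X]s0 -sumrB.
  apply: eq_bigr => j _.
  by rewrite /touch_center addrAC subrr add0r scalerN scalerA -at_ -scalerBl -scaleNr opprB.
(* Otherwise [c - v k] is a convex combination of [c0 - v k], of length [r < rho] and with positive
   weight, and of vectors of length [rho]; then [c] is closer than [rho] to [v k]. *)
have t1 : 1 <= \sum_j t j.
  rewrite leNgt; apply/negP => t1.
  pose u := c - v k.
  have uE : u = (1 - \sum_j t j) *: (c0 - v k) +
      \sum_j t j *: (touch_center rho j - v k).
    have -> : u = w + (c0 - v k) by rewrite /u /w addrA subrK.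
    rewrite wE scalerBl scale1r -[RHS]addrA [LHS]addrC; congr (_ + _).
    rewrite [RHS]addrC scaler_suml -sumrB; apply: eq_bigr => j _.
    by rewrite -scalerBr opprB addrA subrK.
  (* The [k]-th touching centre is farther than [rho] from [v k], but its coefficient [t k]
     vanishes. *)
  have tcE j : t j * sqdist (touch_center rho j) (v k) = t j * rho ^+ 2.
    have [->|jk] := eqVneq j k; first by rewrite tk !mul0r.
    by rewrite sqdist_touch// copower_vertex bary_vertex// (negPf jk) mulr0 subr0 addr0.
  have amgm (y z : 'rV[R]_n.+1) : 2 * dotv y z <= dotv y y + dotv z z.
    by have := dotvv_ge0 (y - z); rewrite !dotvBl !dotvBr (dotvC z y); lra.
  have : 2 * dotv u u <= (1 - \sum_j t j) * (r ^+ 2 + dotv u u) +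
      \sum_j t j * (rho ^+ 2 + dotv u u).
    rewrite {1}uE dotvDl mulrDr dotvZl dotv_suml mulrCA lerD//.
      rewrite ler_wpM2l ?subr_ge0 ?(ltW t1)//.
      by rewrite (le_trans (amgm _ _))// lerD2r -(sqdist_circumcenter k).
    rewrite mulr_sumr; apply: ler_sum => j _; rewrite dotvZl mulrCA mulrDr -tcE -mulrDr.
    by rewrite ler_wpM2l.
  rewrite -mulr_suml; move: (cv k); rewrite /sqdist -/u.
  have := sqr_circumradius_lt rr.
  have : 0 < 1 - \sum_j t j by rewrite subr_gt0.
  nra.
(* The right-hand side is nonnegative, since the sum is at least [copower x] times [\sum_j t j]; so
   [x] is no closer to [c] than [v k] is. *)
have : sqdist c x - sqdist c (v k) = - copower x + \sum_j t j * (2 * offset rho j * mu j x).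
  rewrite (sqdist_split c c0 x) (sqdist_split c c0 (v k)) -/w sqdist_circumcenter.
  rewrite /copower.
  have -> : \sum_j t j * (2 * offset rho j * mu j x) = 2 * (dotv w (v k) - dotv w x).
    rewrite -[X in _ = 2 * (_ - dotv w X)](bary_comb hv x) dotv_sumr.
    rewrite -[dotv w (v k)]mul1r -(bary_sum v x) mulr_suml -sumrB mulr_sumr; apply: eq_bigr => j _.
    by rewrite dotvZr -mulrBr -/(a j) at_; ring.
  by rewrite !dotvBr; ring.
have : copower x <= \sum_j t j * (2 * offset rho j * mu j x).
  rewrite (@le_trans _ _ (\sum_j t j * copower x))//.
    by rewrite -mulr_suml ler_peMl.
  by apply: ler_sum => j _; rewrite ler_wpM2l//; have [] := hx j.
have := cv k; lra.
Qed.

End circumsphere.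

(** Around an interior point the range would contain [x + t *: const_mx 1] for all small positive
    [t], whereas each [f i] accounts for at most one [t]. *)
Lemma interior_finite (R : realType) (n : nat) (I : finType)
    (f : I -> 'rV[R]_n.+1) : (range f)° = set0.
Proof.
rewrite -subset0 => x fx.
have near_neq (s : R) : \forall t \near 0^'+, t != s.
  have [s0|s0] := leP s 0; near=> t.
    by rewrite gt_eqF// (le_lt_trans s0)//; near: t; exact: nbhs_right_gt.
  by rewrite lt_eqF//; near: t; exact: nbhs_right_lt.
have line : x + t *: const_mx 1 @[t --> (0 : R)] --> x.
  rewrite -[X in _ --> X]addr0 -[X in _ + X](scale0r (const_mx 1)).
  by apply: cvgD; [exact: cvg_cst|apply: cvgZr_tmp; exact: cvg_id].
have near_f : \forall t \near (0 : R)^'+, range f (x + t *: const_mx 1).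
  exact: (cvg_at_right_filter line) fx.
have near_notf : \forall t \near (0 : R)^'+,
    forall i, t != (f i - x) ord0 ord0.
  exact: filter_forall.
have [t [[i _ fi]]] := filter_ex (filterI near_f near_notf).
by move=> /(_ i); rewrite fi addrAC subrr add0r !mxE mulr1 eqxx.
Unshelve. all: by end_near. Qed.

(** * The quantity [gap] and the critical radius [rL] *)

Section gap.
Variables (R : realType) (n : nat) (v : 'I_n.+2 -> 'rV[R]_n.+1).
Hypothesis hv : row_free (edge_mx v).
Implicit Types (rho : R) (x y z c : 'rV[R]_n.+1) (i j k : 'I_n.+2).

Local Notation mu := (bary v).
Local Notation r := (circumradius (range v)).
Local Notation q := (copower v).

Definition weight rho j := (2 * offset v rho j)^-1.
Definition total_weight rho := \sum_j weight rho j.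
Definition pole rho := \sum_j (weight rho j / total_weight rho) *: v j.
Definition gap rho := total_weight rho * q (pole rho).

Lemma offset2_gt0 rho j : r < rho -> 0 < 2 * offset v rho j.
Proof. by move=> rr; rewrite mulr_gt0// offset_gt0. Qed.

Lemma weight_gt0 rho j : r < rho -> 0 < weight rho j.
Proof. by move=> rr; rewrite invr_gt0 offset2_gt0. Qed.

Lemma total_weight_gt0 rho : r < rho -> 0 < total_weight rho.
Proof.
move=> rr; rewrite /total_weight (bigD1 ord0)//= ltr_pwDl ?weight_gt0//.
by apply: sumr_ge0 => j _; rewrite ltW// weight_gt0.
Qed.

Lemma bary_pole rho j : r < rho ->
  mu j (pole rho) = weight rho j / total_weight rho.
Proof.
move=> rr; rewrite bary_of_comb// -mulr_suml divff// gt_eqF//.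
exact: total_weight_gt0.
Qed.

Lemma bary_pole_gt0 rho j : r < rho -> 0 < mu j (pole rho).
Proof.
by move=> rr; rewrite bary_pole// divr_gt0 ?weight_gt0 ?total_weight_gt0.
Qed.

Lemma weight_lt rho rho' j : r < rho -> rho < rho' ->
  weight rho' j < weight rho j.
Proof.
move=> rr rr'; have rr2 := lt_trans rr rr'.
by rewrite ltf_pV2 ?posrE ?offset2_gt0// ltr_pM2l// offset_lt.
Qed.

Lemma hulloid_weight rho x : r < rho -> hulloid rho (range v) x <->
  forall j, 0 <= mu j x /\ weight rho j * q x <= mu j x.
Proof.
move=> rr; rewrite (hulloidP hv x rr).
have E j : (weight rho j * q x <= mu j x) = (q x <= 2 * offset v rho j * mu j x).
  by rewrite ler_pdivrMl ?offset2_gt0.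
by split=> hx j; have := hx j; rewrite E.
Qed.

(** Leibniz's formula is used at [x] twice, with the coordinates of [x] and with those of the
    pole. *)
Lemma excess_identity rho x : r < rho ->
  \sum_j (mu j x - weight rho j * q x) * sqdist x (v j) =
  q x * (1 - gap rho - total_weight rho * sqdist x (pole rho)).
Proof.
move=> rr; under eq_bigr do rewrite mulrBl.
rewrite sumrB leibniz// sqdistxx add0r.
have -> : \sum_j weight rho j * q x * sqdist x (v j) =
    q x * total_weight rho * \sum_j mu j (pole rho) * sqdist x (v j).
  rewrite mulr_sumr; apply: eq_bigr => j _; rewrite bary_pole//.
  by field; rewrite gt_eqF// total_weight_gt0.
by rewrite leibniz// /gap; ring.
Qed.

Lemma hulloid_gap rho x : r < rho -> hulloid rho (range v) x -> ~ range v x ->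
  gap rho + total_weight rho * sqdist x (pole rho) <= 1.
Proof.
move=> rr /(hulloid_weight _ rr) hx xv.
have x0 j : 0 <= mu j x by have [] := hx j.
have qx : 0 < q x.
  rewrite lt_neqAle copower_ge0// andbT; apply/negP => /eqP q0.
  by apply: xv; exact: copower_eq0.
have : 0 <= \sum_j (mu j x - weight rho j * q x) * sqdist x (v j).
  apply: sumr_ge0 => j _; rewrite mulr_ge0 ?sqdist_ge0// subr_ge0.
  by have [] := hx j.
by rewrite excess_identity// pmulr_rge0// => ?; lra.
Qed.

(** Strictness survives summation because some vertex differs from [x]. *)
Lemma gap_lt1 rho x : r < rho -> 0 < q x ->
  (forall j, weight rho j * q x < mu j x) -> gap rho < 1.
Proof.
move=> rr qx hx.
have : 0 < \sum_j (mu j x - weight rho j * q x) * sqdist x (v j).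
  by apply: weighted_sqdist_gt0 => // j; rewrite subr_gt0.
rewrite excess_identity// pmulr_rgt0//.
have : 0 <= total_weight rho * sqdist x (pole rho).
  by rewrite mulr_ge0 ?sqdist_ge0// ltW// total_weight_gt0.
lra.
Qed.

(** Both sides carry the factor [weight rho j]; dividing it out leaves [gap rho <= 1] for every
    [j]. *)
Lemma weight_pole rho j : r < rho -> gap rho <= 1 ->
  weight rho j * q (pole rho) <= mu j (pole rho).
Proof.
move=> rr g1; rewrite bary_pole// ler_pM2l ?weight_gt0// -[leRHS]mul1r.
by rewrite ler_pdivlMr ?total_weight_gt0// mulrC.
Qed.

(** The pole of the smaller radius serves as test point for the larger one: the weights have
    decreased, so its weak inequalities become strict. *)
Lemma gap_crossing rho rho' : r < rho -> rho < rho' -> gap rho <= 1 ->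
  gap rho' < 1.
Proof.
move=> rr rr' g1; have rr2 := lt_trans rr rr'.
have qp : 0 < q (pole rho) by apply: copower_gt0 => // j; exact: bary_pole_gt0.
apply: (@gap_lt1 _ (pole rho)) => // j.
rewrite (@lt_le_trans _ _ (weight rho j * q (pole rho)))//.
  by rewrite ltr_pM2r// weight_lt.
exact: weight_pole.
Qed.

Lemma vertex_in_hulloid rho i : hulloid rho (range v) (v i).
Proof.
move=> c /= cv civ; have : (eball c rho `&` range v) (v i) by split=> //; exists i.
by rewrite cv.
Qed.

Lemma pole_in_hulloid rho : r < rho -> gap rho <= 1 ->
  hulloid rho (range v) (pole rho).
Proof.
move=> rr g1; apply/hulloid_weight => // j; split.
  by rewrite ltW// bary_pole_gt0.
exact: weight_pole.
Qed.

Lemma hulloid_sub rho : r < rho -> 1 <= gap rho ->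
  hulloid rho (range v) `<=` range v `|` [set pole rho].
Proof.
move=> rr g1 x hx; have [|xv] := pselect (range v x); [by left|right].
have := hulloid_gap rr hx xv; have w0 := total_weight_gt0 rr => gx.
apply/eqP; rewrite -sqdist_eq0 eq_le sqdist_ge0 andbT.
by rewrite -(pmulr_rle0 _ w0); lra.
Qed.

Lemma hulloid_gap1 rho : r < rho -> gap rho = 1 ->
  hulloid rho (range v) = range v `|` [set pole rho].
Proof.
move=> rr g1; apply/seteqP; split; first by apply: hulloid_sub; rewrite ?g1.
by move=> _ [[i _ <-]|->]; [exact: vertex_in_hulloid|apply: pole_in_hulloid; rewrite ?g1].
Qed.

(** If [1 <= gap rho] the hulloid is finite. If [gap rho < 1] all inequalities are strict at the
    pole, hence persist around it by continuity. *)
Lemma full_hulloidP rho : r < rho -> full_hulloid rho (range v) <-> gap rho < 1.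
Proof.
move=> rr; split => [[x hx]|g1].
  rewrite ltNge; apply/negP => g1.
  have : (range (fun o => if o is Some i then v i else pole rho))° x.
    apply: interiorS hx => y /(hulloid_sub rr g1)[[i _ <-]|->].
      by exists (Some i).
    by exists None.
  by rewrite interior_finite.
exists (pole rho).
have near_pole j : \forall x \near pole rho,
    0 < mu j x /\ weight rho j * q x < mu j x.
  have cm : mu j x @[x --> pole rho] --> mu j (pole rho).
    exact: bary_continuous.
  have cq : mu j x - weight rho j * q x @[x --> pole rho] -->
      mu j (pole rho) - weight rho j * q (pole rho).
    apply: (@cvgB _ _ _ (nbhs (pole rho))) => //.
    apply: (@cvgM _ _ (nbhs (pole rho))); first exact: cvg_cst.
    exact: copower_continuous.
  apply: (@filterS2 _ (nbhs (pole rho)) _ (fun x => 0 < mu j x)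
    (fun x => 0 < mu j x - weight rho j * q x)).
  - by move=> x m0 mq; split=> //; rewrite -subr_gt0.
  - by apply: (cvgr_gt _ cm); exact: bary_pole_gt0.
  - apply: (cvgr_gt _ cq); rewrite subr_gt0 bary_pole// ltr_pM2l ?weight_gt0//.
    rewrite -[ltRHS]mul1r ltr_pdivlMr ?total_weight_gt0//.
    by rewrite mulrC.
have /filterS : \forall x \near pole rho,
    forall j, 0 < mu j x /\ weight rho j * q x < mu j x.
  exact: (@filter_forall _ _ _ (nbhs (pole rho)) _ near_pole).
apply => x hx; apply/hulloid_weight => // j.
by have [/ltW ? /ltW ?] := hx j.
Qed.

Lemma gap_lt1_large : exists2 rho, r < rho & gap rho < 1.
Proof.
have r0 := circumradius_gt0 hv.
(* If all offsets exceed this [s], the total weight is at most [(2 * r ^+ 2)^-1]; as [q] is at most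
   [r ^+ 2], the gap is then at most one half. *)
pose s : R := n.+2%:R * r ^+ 2.
pose E j := dotv (bary_grad v j) (bary_grad v j).
pose F j := E j * s ^+ 2 - 2 * mu j (circumcenter v) * s.
(* This [k] exceeds the value at [s] of each quadratic, so each positive root for
   [rho ^+ 2 - r ^+ 2 = k] lies beyond [s]. *)
pose k := 1 + \sum_j `|F j|.
have s0 : 0 < s by rewrite mulr_gt0 ?ltr0n// exprn_gt0.
have k0 : 0 < k by rewrite ltr_pwDl// sumr_ge0.
have Fk j : F j < k.
  rewrite (le_lt_trans (ler_norm _))// /k (bigD1 j)//= addrCA ltrDl.
  by rewrite ltr_pwDl// sumr_ge0.
pose rho := Num.sqrt (r ^+ 2 + k).
have rhoE : rho ^+ 2 = r ^+ 2 + k by rewrite sqr_sqrtr// addr_ge0 ?sqr_ge0 ?ltW.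
have rr : r < rho.
  rewrite -[ltLHS]gtr0_norm// -sqrtr_sqr ltr_sqrt ?ltrDl//.
  by rewrite addr_gt0// exprn_gt0.
exists rho => //.
have ws j : weight rho j < (2 * s)^-1.
  rewrite ltf_pV2 ?posrE ?offset2_gt0 ?(mulr_gt0 _ s0)// ltr_pM2l//.
  apply: lt_qroot => //; rewrite ?bary_grad_sqr_gt0// rhoE addrAC subrr add0r//.
  exact: Fk.
have : total_weight rho <= n.+2%:R * (2 * s)^-1.
  rewrite (le_trans (ler_sum _ (fun j _ => ltW (ws j))))//.
  by rewrite sumr_const card_ord -[leLHS]mulr_natl.
have -> : n.+2%:R * (2 * s)^-1 = (2 * r ^+ 2)^-1.
  by rewrite /s mulrCA invfM mulVKf ?pnatr_eq0.
move=> wr; have w0 := total_weight_gt0 rr.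
have : q (pole rho) <= r ^+ 2 by rewrite gerBl sqdist_ge0.
rewrite /gap -(ler_pM2l w0) => /le_lt_trans; apply.
rewrite (@le_lt_trans _ _ ((2 * r ^+ 2)^-1 * r ^+ 2))//.
  by rewrite ler_wpM2r ?sqr_ge0.
rewrite invfM mulfVK ?gt_eqF ?exprn_gt0//.
by rewrite invf_lt1 ?ltr1n.
Qed.

Lemma weight_continuous rho j : r < rho ->
  weight t j @[t --> rho] --> weight rho j.
Proof.
move=> rr; apply: cvgV; first by rewrite gt_eqF// offset2_gt0.
apply: cvgM; first exact: cvg_cst.
apply: cvgM; last exact: cvg_cst.
apply: cvgD; first exact: cvg_cst.
apply: continuous_cvg; first exact: sqrt_continuous.
apply: cvgD; first exact: cvg_cst.
apply: cvgM; first exact: cvg_cst.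
by apply: cvgB; [exact: exprn_continuous|exact: cvg_cst].
Qed.

Lemma gap_continuous rho : r < rho -> gap t @[t --> rho] --> gap rho.
Proof.
move=> rr.
have cw : total_weight t @[t --> rho] --> total_weight rho.
  by apply: cvg_sumr => j; exact: weight_continuous.
apply: cvgM => //; apply: continuous_cvg; first exact: copower_continuous.
apply: cvg_sumr => j; apply: cvgZr_tmp; apply: cvgM; first exact: weight_continuous.
by apply: cvgV => //; rewrite gt_eqF// total_weight_gt0.
Qed.

Lemma rL_gap : rL (range v) = inf [set rho | r < rho /\ gap rho < 1].
Proof.
congr inf; apply/seteqP; split=> rho /= [rr];
by move/full_hulloidP => H; split=> //; apply: H.
Qed.

(** By continuity, a gap below 1 at the infimum would persist at smaller radii still above [r], and
    a gap above 1 would keep the set away from its infimum. *)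
Lemma gap_rL : r < rL (range v) -> gap (rL (range v)) = 1.
Proof.
move=> rl; have gc := gap_continuous rl.
pose F := [set rho | r < rho /\ gap rho < 1].
have F0 : F !=set0 by have [rho ? ?] := gap_lt1_large; exists rho.
have lF : has_lbound F by exists r => rho [/ltW].
have rLE : rL (range v) = inf F by exact: rL_gap.
have [g1|g1|//] := ltgtP (gap (rL (range v))) 1; exfalso.
- have near_lt : \forall t \near (rL (range v))^'-, gap t < 1.
    exact: (cvgr_lt _ (cvg_at_left_filter gc)).
  have near_gt : \forall t \near (rL (range v))^'-, r < t.
    exact: nbhs_left_gt.
  have near_l : \forall t \near (rL (range v))^'-, t < rL (range v).
    exact: nbhs_left_lt.
  have /(@filter_ex _ _ (at_left_proper_filter _))[t [[tg rt] tl]] :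
      \forall t \near (rL (range v))^'-, (gap t < 1 /\ r < t) /\ t < rL (range v).
    by apply: filterI => //; exact: filterI.
  by have := ge_inf lF (conj rt tg : F t); rewrite -rLE leNgt tl.
- have /nbhs_ballP[e /= e0 eP] : \forall t \near rL (range v), 1 < gap t.
    exact: (cvgr_gt _ gc).
  have [t Ft] := inf_adherent e0 (conj F0 lF).
  rewrite -rLE => te; have tl : rL (range v) <= t by rewrite rLE; exact: ge_inf.
  have : 1 < gap t.
    by apply: eP; rewrite /ball/= ltr_distlC; apply/andP; split; lra.
  by move: Ft => [_ ?]; lra.
Qed.

(** By [gap_crossing] the radii with gap below 1 form exactly the open half-line beyond [rho]. *)
Lemma gap1_rL rho : r < rho -> gap rho = 1 -> rL (range v) = rho.
Proof.
move=> rr g1; rewrite rL_gap -[RHS](@inf_itv _ +oo%O false rho)//.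
congr inf; apply/seteqP; split=> t /=; rewrite in_itv/= andbT.
  move=> [rt gt]; rewrite ltNge; apply/negP; rewrite le_eqVlt => /predU1P[trho|trho].
    by move: gt; rewrite trho g1 ltxx.
  by have := gap_crossing rt trho (ltW gt); rewrite g1 ltxx.
move=> rt; split; first exact: lt_trans rt.
by apply: gap_crossing rt _ => //; rewrite g1.
Qed.

End gap.

(** Normalising by the total weight lets the induction hypothesis apply to all points but the last;
    positive weights keep the partial sums invertible. *)
Lemma convex_set_barycenter (R : realType) (V : lmodType R) (A : set V) (m : nat)
    (a : 'I_m.+1 -> R) (p : 'I_m.+1 -> V) :
  convex_set A -> (forall i, 0 < a i) -> (forall i, A (p i)) ->
  A ((\sum_i a i)^-1 *: \sum_i a i *: p i).
Proof.
move=> cA; elim: m a p => [|m IHm] a p a0 Ap.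
  by rewrite !big_ord1 scalerA mulVf ?scale1r// gt_eqF.
pose w := widen_ord (leqnSn m.+1).
pose S := \sum_i a (w i); pose P := \sum_i a (w i) *: p (w i).
have AP : A (S^-1 *: P) by exact: IHm.
rewrite !(big_ord_recr m.+1)/= -/w -/S -/P.
have S0 : 0 < S.
  rewrite /S big_ord_recl ltr_pwDl// sumr_ge0// => i _; exact: ltW.
have T0 : 0 < S + a ord_max by rewrite addr_gt0.
have l0 : 0 <= S / (S + a ord_max) by rewrite divr_ge0 ?ltW.
have l1 : S / (S + a ord_max) <= 1.
  by rewrite ler_pdivrMr// mul1r lerDl ltW.
suff -> : (S + a ord_max)^-1 *: (P + a ord_max *: p ord_max) =
    conv (Itv01 l0 l1) (S^-1 *: P : convex_lmodType V) (p ord_max).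
  by have := cA (S^-1 *: P) (p ord_max) (Itv01 l0 l1); rewrite !inE; apply.
rewrite /conv/= scalerA scalerDr scalerA; congr (_ *: _ + _ *: _).
  by rewrite mulrAC divff ?mul1r// gt_eqF.
by rewrite -[RHS]/(1 - S / (S + a ord_max)); field; rewrite gt_eqF.
Qed.

(** * Interior of the simplex and common points of the touching spheres *)

Section simplex_hull.
Variables (R : realType) (n : nat) (v : 'I_n.+2 -> 'rV[R]_n.+1).
Hypothesis hv : row_free (edge_mx v).
Implicit Types (rho : R) (x c : 'rV[R]_n.+1) (i j : 'I_n.+2).

Local Notation mu := (bary v).
Local Notation grad := (bary_grad v).
Local Notation c0 := (circumcenter v).
Local Notation r := (circumradius (range v)).
Local Notation q := (copower v).

Lemma bary_gt0_interior x : (forall j, 0 < mu j x) ->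
  (convex_hull (range v))° x.
Proof.
move=> x0.
have near_x : \forall y \near x, forall j, 0 < mu j y.
  apply: (@filter_forall _ _ _ (nbhs x)) => j.
  have cm : mu j y @[y --> x] --> mu j x by exact: bary_continuous.
  exact: (cvgr_gt _ cm).
apply: filterS near_x => y y0 A [cA vA].
rewrite -(bary_comb hv y) -[X in A X]scale1r -invr1 -(bary_sum v y).
by apply: convex_set_barycenter => // i; apply: vA; exists i.
Qed.

(** Equidistance from the face opposite [v j] makes [c - c0] a multiple of [grad j], and avoiding
    [v j] selects the positive root. *)
Lemma touch_center_unique rho c j : r < rho ->
  (forall i, i != j -> sqdist c (v i) = rho ^+ 2) ->
  rho ^+ 2 <= sqdist c (v j) -> c = touch_center v rho j.
Proof.
move=> rr cv cj.
(* The common value of [dotv (c - c0) (v i)] for [i != j]. *)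
pose k := (dotv c c - dotv c0 c0 - rho ^+ 2 + r ^+ 2) / 2.
pose s := k - dotv (c - c0) (v j).
have cE : c = c0 - s *: grad j.
  rewrite -[LHS](subrK c0) addrC; congr (_ + _).
  have k0 : \sum_i k *: grad i = 0 by rewrite -scaler_sumr bary_grad_sum scaler0.
  rewrite -[LHS](dotv_vertices hv) -[LHS]subr0 -[X in _ - X]k0 -sumrB.
  rewrite (bigD1 j)//= big1 => [|i ij].
    by rewrite addr0 -scalerBl -[RHS]scaleNr opprB.
  rewrite -scalerBl; apply/eqP; rewrite scaler_eq0 subr_eq0; apply/orP; left.
  apply/eqP; have := cv i ij; have := sqdist_circumcenter hv i.
  rewrite /sqdist !dotvBl !dotvBr (dotvC (v i) c) (dotvC (v i) c0) /k; lra.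
have [i ij] := exists_neq j.
have := cv i ij; move: cj; rewrite cE !sqdist_shift !sqdist_circumcenter// !bary_vertex//.
rewrite eqxx eq_sym (negPf ij) => cj ci.
have rho2 := sqr_circumradius_lt hv rr.
(* Comparing the distances to [v j] and [v i] gives [0 <= s]; [s = 0] would force
   [rho ^+ 2 = r ^+ 2]. *)
have s0 : 0 < s.
  rewrite lt_neqAle; apply/andP; split; last by move: cj ci; rewrite /=; lra.
  by apply/negP => /eqP s0; move: ci; rewrite -s0; lra.
rewrite /touch_center; congr (_ - _ *: _).
by apply: qroot_unique => //; [exact: bary_grad_sqr_gt0|move: ci; rewrite /=; lra].
Qed.

(** Lying on all the spheres means [mu j x = weight v rho j * q x] for every [j]; summing over [j]
    gives [total_weight v rho * q x = 1], which determines the coordinates of [x]. *)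
Lemma poleP rho x : r < rho ->
  (forall j, sqdist (touch_center v rho j) x = rho ^+ 2) <->
  x = pole v rho /\ gap v rho = 1.
Proof.
move=> rr; have w0 := total_weight_gt0 hv rr; split=> [hx|[-> g1] j]; last first.
  rewrite sqdist_touch// bary_pole//.
  have -> : q (pole v rho) = (total_weight v rho)^-1.
    by rewrite -[RHS]mulr1 -g1 /gap mulKf// gt_eqF.
  have o0 := offset2_gt0 hv j rr.
  by rewrite mulrA divff ?gt_eqF// mul1r subrK.
have mx j : mu j x = weight v rho j * q x.
  have := hx j; rewrite sqdist_touch// => E.
  have o0 := offset2_gt0 hv j rr.
  have -> : q x = 2 * offset v rho j * mu j x by lra.
  by rewrite mulKf// gt_eqF.
have wq : total_weight v rho * q x = 1.
  rewrite mulr_suml -[RHS](bary_sum v x).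
  by apply: eq_bigr => j _; rewrite mx.
have xp : x = pole v rho.
  apply: (bary_eq hv) => j; rewrite mx bary_pole//; congr (_ * _).
  by rewrite -[RHS]mulr1 -wq mulKf// gt_eqF.
by rewrite /gap -xp.
Qed.

End simplex_hull.

(** By [touch_center_unique] the only possible centres are the touching centres, so [poleP] decides
    the existence of a common point. *)
Lemma four_spheresP (R : realType) (v : 'I_4 -> 'rV[R]_3)
    (hv : nondegenerate_tetrahedron v) (Rs : R) (O : 'rV[R]_3) :
  (exists c, four_spheres v Rs O c) <->
  [/\ circumradius (range v) < Rs, gap v Rs = 1 & O = pole v Rs].
Proof.
have fv : row_free (edge_mx v) by [].
split=> [[c [rr _ _ hc]]|[rr g1 ->]].
  have r0 := lt_trans (circumradius_gt0 fv) rr.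
  suff /(poleP fv O rr)[] : forall j, sqdist (touch_center v Rs j) O = Rs ^+ 2 by [].
  move=> j; have [cs ce cO] := hc j.
  rewrite -(@touch_center_unique _ _ v fv Rs (c j) j)//.
  - exact/edist_eqE.
  - move=> i ij; apply/edist_eqE => //; apply: cs; split; first by exists i.
    by move=> /= /(vertex_inj fv) ji; move: ij; rewrite ji eqxx.
  - by move: ce => /(eball_emptyP _ _ r0); exact.
have r0 := lt_trans (circumradius_gt0 fv) rr.
have on_sphere j i : esphere (touch_center v Rs j) Rs (v i) <-> i != j.
  rewrite /esphere/= edist_eqE// sqdist_touch// copower_vertex// subr0 bary_vertex//.
  rewrite eq_sym; have [->|ij] := eqVneq j i.
    by split=> // /eqP; rewrite mulr1 -subr_eq0 addrAC subrr add0r gt_eqF// offset2_gt0.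
  by rewrite mulr0 addr0.
exists (touch_center v Rs); split=> //.
- by apply: bary_gt0_interior => // j; exact: bary_pole_gt0.
(* Among the vertices, the [i]-th sphere misses exactly [v i], so equal spheres have equal
   indices. *)
- move=> i j /(congr1 (fun S => S (v i))) ij; apply/eqP; apply/negPn/negP => nij.
  have /on_sphere : esphere (touch_center v Rs i) Rs (v i).
    by rewrite ij; apply/on_sphere.
  by rewrite eqxx.
- move=> j; split.
  + move=> _ [[i _ <-] ij]; apply/on_sphere.
    by apply/negP => /eqP ij'; apply: ij; rewrite ij'.
  + by apply/eball_emptyP => // i; exact: touch_avoids.
  + by apply/edist_eqE => //; exact: (poleP fv _ rr).2.
Qed.

Theorem theorem4p8 (R : realType) (v : 'I_4 -> 'rV[R]_3)
    (hv : nondegenerate_tetrahedron v) :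
  ((exists (Rs : R) (O : 'rV[R]_3) (c : 'I_4 -> 'rV[R]_3),
       four_spheres v Rs O c)
     <-> circumradius (range v) < rL (range v))
  /\ (forall (Rs : R) (O : 'rV[R]_3) (c : 'I_4 -> 'rV[R]_3),
        four_spheres v Rs O c ->
        Rs = rL (range v) /\ hulloid Rs (range v) = range v `|` [set O]).
Proof.
have fv : row_free (edge_mx v) by [].
split; last first.
  move=> Rs O c /(ex_intro (four_spheres v Rs O) c) /(four_spheresP hv)[rr g1 ->].
  by rewrite (gap1_rL fv rr g1) hulloid_gap1.
split=> [[Rs [p /(four_spheresP hv)[rr g1 _]]]|rr].
  by rewrite (gap1_rL fv rr g1).
exists (rL (range v)), (pole v (rL (range v))); apply/(four_spheresP hv).
by split=> //; exact: gap_rL.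
Qed.
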